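(* Let $R(q)=\dfrac{(q;q^5)_\infty(q^4;q^5)_\infty}{(q^2;q^5)_\infty(q^3;q^5)_\infty}$ and define the coefficients $B(n)$, $n\ge 0$, by the power series expansion $$R^5(q)=\sum_{n=0}^{\infty}B(n)q^n,\qquad |q|<1.$$ Then $B(0)>0$ and $B(5)<0$.
   Context: For complex numbers $a,q$ with $|q|<1$, $(a;q)_\infty:=\prod_{k=0}^{\infty}(1-aq^k)$. The function $R(q)$ is the Rogers-Ramanujan continued fraction without its factor $q^{1/5}$, i.e. $R(q)=\cfrac{1}{1+\cfrac{q}{1+\cfrac{q^2}{1+\cfrac{q^3}{1+\cdots}}}}$, which equals the infinite product $\dfrac{(q;q^5)_\infty(q^4;q^5)_\infty}{(q^2;q^5)_\infty(q^3;q^5)_\infty}$ (a classical identity of Rogers and Ramanujan). Here $R^5(q)$ denotes $(R(q))^5$. *)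

(* Defs.v *)
From Stdlib Require Import Reals.
From Coquelicot Require Import Coquelicot.
Open Scope R_scope.

Fixpoint Cprod (f : nat -> C) (N : nat) : C :=
  match N with
  | O => RtoC 1
  | S N' => (Cprod f N' * f N')%C
  end.

(* [lim] is total: its value is meaningful only when the partial products
   converge, as they do for [|q| < 1]. *)
Definition qpoch_inf (a q : C) : C :=
  lim (T := C_CompleteNormedModule)
    (filtermap (Cprod (fun k => 1 - a * q ^ k)%C) eventually).

Definition RR (q : C) : C :=
  (qpoch_inf q (q ^ 5) * qpoch_inf (q ^ 4) (q ^ 5)
   / (qpoch_inf (q ^ 2) (q ^ 5) * qpoch_inf (q ^ 3) (q ^ 5)))%C.

(* The coefficients are taken real, so that their signs make sense; the
   variable [q] and the convergence are complex. *)
Definition RR5_expansion (B : nat -> R) : Prop :=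
  forall q : C, Cmod q < 1 ->
    is_pseries (K := C_AbsRing) (V := C_NormedModule)
      (fun n => RtoC (B n)) q (RR q ^ 5)%C.

(* Main.v *)
Require Import Defs.
From Stdlib Require Import Reals ZArith List Lra Lia.
From Coquelicot Require Import Coquelicot.
Import ListNotations.
Open Scope R_scope.

(** Each partial product of [R^5] is a finite product of factors [1 - q^m] and
    [1 / (1 - q^m)], hence a power series with integer coefficients that can be
    computed exactly.  The coefficient of [q^n] no longer changes once all new
    exponents exceed [n].  For [0 <= r < 1], multiplying or dividing by [1 - q^m]
    multiplies [sup_n |a_n| r^n] by at most [1 / (1 - r^m)], and these constants
    have a bounded product; so the partial products converge to the series of
    the stable coefficients.  That series is the only expansion of [R^5], and its
    coefficients of index 0 and 5 are 1 and -26. *)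

(** * Formal multiplication and division by [1 - q^m] on integer coefficients *)

Definition zshift (m : nat) (a : nat -> Z) (n : nat) : Z :=
  if (n <? m)%nat then 0%Z else a (n - m)%nat.

Definition mul_fac (m : nat) (a : nat -> Z) (n : nat) : Z := (a n - zshift m a n)%Z.

(** Unfolds [b n = a n + b (n - m)], the recurrence satisfied by the quotient. The call at [n - m]
    is not structural, hence the fuel; for positive [m] the index drops at each call, so fuel [S n]
    suffices, and the definition stays executable. *)
Fixpoint div_fac_aux (fuel m : nat) (a : nat -> Z) (n : nat) : Z :=
  match fuel with
  | O => 0%Z
  | S f => (a n + if (n <? m)%nat then 0 else div_fac_aux f m a (n - m))%Z
  end.

Definition div_fac (m : nat) (a : nat -> Z) (n : nat) : Z := div_fac_aux (S n) m a n.

Lemma div_fac_aux_fuel (m : nat) (a : nat -> Z) (f f' n : nat) :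
  (0 < m)%nat -> (n < f)%nat -> (n < f')%nat ->
  div_fac_aux f m a n = div_fac_aux f' m a n.
Proof.
  intros Hm; revert f' n.
  induction f as [|f IH]; intros [|f'] n Hf Hf'; try lia.
  cbn [div_fac_aux]; destruct (Nat.ltb_spec n m); [reflexivity|].
  rewrite (IH f'); [reflexivity|lia|lia].
Qed.

Lemma div_fac_eq (m : nat) (a : nat -> Z) (n : nat) :
  (0 < m)%nat -> div_fac m a n = (a n + zshift m (div_fac m a) n)%Z.
Proof.
  intros Hm; unfold div_fac at 1, zshift; cbn [div_fac_aux].
  destruct (Nat.ltb_spec n m); [reflexivity|].
  unfold div_fac; rewrite (div_fac_aux_fuel m a n (S (n - m))); [reflexivity|lia|lia|lia].
Qed.

(* [(false, m)] stands for the factor [1 - q^m], [(true, m)] for its inverse. *)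
Notation factor := (bool * nat)%type.

Definition fac_coeffs (s : factor) : (nat -> Z) -> nat -> Z :=
  if fst s then div_fac (snd s) else mul_fac (snd s).

Definition fac_value (q : C) (s : factor) : C :=
  if fst s then (/ (1 - q ^ snd s))%C else (1 - q ^ snd s)%C.

Fixpoint coeffs (l : list factor) : nat -> Z :=
  match l with
  | [] => fun n => if (n =? 0)%nat then 1%Z else 0%Z
  | s :: l' => fac_coeffs s (coeffs l')
  end.

Fixpoint value (q : C) (l : list factor) : C :=
  match l with
  | [] => RtoC 1
  | s :: l' => (fac_value q s * value q l')%C
  end.

(** The flag is ignored on purpose: for the norm [sup |a_n| r^n], division by [1 - q^m] costs at
    most [/ (1 - r^m)], and this also dominates the cost [1 + r^m] of multiplication. *)
Fixpoint fac_majorant (r : R) (l : list factor) : R :=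
  match l with
  | [] => 1
  | s :: l' => / (1 - r ^ snd s) * fac_majorant r l'
  end.

Lemma pow_lt_1 (r : R) (m : nat) : 0 <= r < 1 -> (0 < m)%nat -> 0 <= r ^ m < 1.
Proof.
  intros Hr Hm; split; [apply pow_le; lra|].
  apply pow_lt_1_compat; [lra|lia].
Qed.

Lemma value_app (q : C) (l l' : list factor) :
  value q (l ++ l') = (value q l * value q l')%C.
Proof.
  induction l as [|s l IH]; simpl; [ring|rewrite IH; ring].
Qed.

(** * Growth of the weighted coefficients [|a_n| r^n] *)

Lemma shift_bound (m : nat) (a : nat -> Z) (r K : R) (n : nat) :
  0 <= r -> 0 <= K ->
  ((m <= n)%nat -> Rabs (IZR (a (n - m)%nat)) * r ^ (n - m) <= K) ->
  Rabs (IZR (zshift m a n)) * r ^ n <= r ^ m * K.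
Proof.
  intros Hr HK H; unfold zshift.
  assert (0 <= r ^ m) by (apply pow_le; lra).
  destruct (Nat.ltb_spec n m) as [L|L].
  - rewrite Rabs_R0; nra.
  - replace (r ^ n) with (r ^ m * r ^ (n - m)) by (rewrite <- pow_add; f_equal; lia).
    specialize (H L); nra.
Qed.

Lemma mul_fac_bound (m : nat) (a : nat -> Z) (r K : R) :
  0 <= r < 1 -> (0 < m)%nat ->
  (forall n, Rabs (IZR (a n)) * r ^ n <= K) ->
  forall n, Rabs (IZR (mul_fac m a n)) * r ^ n <= / (1 - r ^ m) * K.
Proof.
  intros Hr Hm H n.
  destruct (pow_lt_1 r m Hr Hm) as [P0 P1].
  assert (HK : 0 <= K).
  { eapply Rle_trans; [|apply (H 0%nat)].
    apply Rmult_le_pos; [apply Rabs_pos|apply pow_le; lra]. }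
  apply Rle_trans with ((1 + r ^ m) * K).
  - unfold mul_fac; rewrite minus_IZR.
    pose proof (shift_bound m a r K n ltac:(lra) HK (fun _ => H (n - m)%nat)) as SB.
    pose proof (H n).
    assert (0 <= r ^ n) by (apply pow_le; lra).
    pose proof (Rabs_triang (IZR (a n)) (- IZR (zshift m a n))) as T.
    rewrite Rabs_Ropp in T; unfold Rminus; nra.
  (* This is [(1 + x) * (1 - x) <= 1] with [x = r^m]. *)
  - apply Rmult_le_compat_r; [exact HK|].
    apply Rmult_le_reg_r with (1 - r ^ m); [lra|].
    rewrite Rinv_l by lra; nra.
Qed.

Lemma div_fac_bound (m : nat) (a : nat -> Z) (r K : R) :
  0 <= r < 1 -> (0 < m)%nat ->
  (forall n, Rabs (IZR (a n)) * r ^ n <= K) ->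
  forall n, Rabs (IZR (div_fac m a n)) * r ^ n <= / (1 - r ^ m) * K.
Proof.
  intros Hr Hm H.
  destruct (pow_lt_1 r m Hr Hm) as [P0 P1].
  assert (HK : 0 <= K).
  { eapply Rle_trans; [|apply (H 0%nat)].
    apply Rmult_le_pos; [apply Rabs_pos|apply pow_le; lra]. }
  assert (HI : 0 < / (1 - r ^ m)) by (apply Rinv_0_lt_compat; lra).
  induction n as [n IH] using lt_wf_ind.
  rewrite div_fac_eq by exact Hm; rewrite plus_IZR.
  (* [shift_bound] asks for the bound at index [n - m] only, which the strong induction hypothesis
     supplies. *)
  pose proof (shift_bound m (div_fac m a) r (/ (1 - r ^ m) * K) n ltac:(lra)
                ltac:(nra) ltac:(intros; apply IH; lia)) as B.
  pose proof (H n).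
  assert (0 <= r ^ n) by (apply pow_le; lra).
  pose proof (Rabs_triang (IZR (a n)) (IZR (zshift m (div_fac m a) n))) as T.
  (* The constant is the fixed point of [c = K + r^m * c], so the recurrence preserves the bound. *)
  replace (/ (1 - r ^ m) * K) with (K + r ^ m * (/ (1 - r ^ m) * K)) by (field; lra).
  nra.
Qed.

Lemma coeffs_bound (r : R) (l : list factor) :
  0 <= r < 1 -> List.Forall (fun s => (0 < snd s)%nat) l ->
  forall n, Rabs (IZR (coeffs l n)) * r ^ n <= fac_majorant r l.
Proof.
  intros Hr Hl; induction Hl as [|[[|] m] l Hm Hl IH]; cbn [coeffs fac_majorant].
  - intros [|n]; cbn [Nat.eqb].
    + rewrite Rabs_R1; simpl; lra.
    + rewrite Rabs_R0; lra.
  - now apply div_fac_bound.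
  - now apply mul_fac_bound.
Qed.

Lemma exp_le_compat (x y : R) : x <= y -> exp x <= exp y.
Proof.
  intros [H| ->]; [left; now apply exp_increasing|apply Rle_refl].
Qed.

Lemma inv_one_minus_le_exp (x : R) : 0 <= x < 1 -> / (1 - x) <= exp (x / (1 - x)).
Proof.
  intros Hx; replace (/ (1 - x)) with (1 + x / (1 - x)) by (field; lra).
  apply exp_ineq1_le.
Qed.

(** Each factor is at most [exp (x / (1 - x))] with [x = r^m]; since [m > k], this exponent is at
    most [r^k / (1 - r)], and there are at most [d] factors. The exponential turns the product over
    blocks into a geometric sum. *)
Lemma fac_majorant_block (r : R) (k d : nat) (l : list factor) :
  0 <= r < 1 -> List.Forall (fun s => (k < snd s)%nat) l -> (length l <= d)%nat ->
  1 <= fac_majorant r l <= exp (INR d * r ^ k / (1 - r)).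
Proof.
  intros Hr Hl; revert d; induction Hl as [|[e m] l Hm Hl IH]; intros d Hd; cbn [fac_majorant].
  - split; [lra|]. rewrite <- exp_0 at 1. apply exp_le_compat.
    apply Rmult_le_pos; [|left; apply Rinv_0_lt_compat; lra].
    apply Rmult_le_pos; [apply pos_INR|apply pow_le; lra].
  - cbn [length] in Hd; destruct d as [|d]; [lia|].
    cbn [snd] in *.
    destruct (IH d ltac:(lia)) as [L U].
    destruct (pow_lt_1 r m Hr ltac:(lia)) as [P0 P1].
    assert (HI : 1 <= / (1 - r ^ m)).
    { rewrite <- Rinv_1 at 1; apply Rinv_le_contravar; lra. }
    split; [nra|].
    replace (INR (S d) * r ^ k / (1 - r))
      with (r ^ k / (1 - r) + INR d * r ^ k / (1 - r)) by (rewrite S_INR; field; lra).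
    rewrite exp_plus; apply Rmult_le_compat; try lra.
    eapply Rle_trans; [apply inv_one_minus_le_exp; lra|].
    apply exp_le_compat.
    assert (0 < / (1 - r)) by (apply Rinv_0_lt_compat; lra).
    assert (/ (1 - r ^ m) <= / (1 - r)).
    { apply Rinv_le_contravar; [lra|].
      replace m with (S (m - 1)) by lia; simpl.
      assert (r ^ (m - 1) <= 1) by (rewrite <- (pow1 (m - 1)); apply pow_incr; lra).
      nra. }
    assert (r ^ m <= r ^ k).
    { replace m with (k + (m - k))%nat by lia; rewrite pow_add.
      assert (r ^ (m - k) <= 1) by (rewrite <- (pow1 (m - k)); apply pow_incr; lra).
      assert (0 <= r ^ k) by (apply pow_le; lra). nra. }
    unfold Rdiv; apply Rmult_le_compat; lra.
Qed.

(** * Products of blocks: uniform majorant and stable coefficients *)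

Fixpoint blocks (b : nat -> list factor) (N : nat) : list factor :=
  match N with
  | O => []
  | S N' => b N' ++ blocks b N'
  end.

Lemma fac_majorant_app (r : R) (l l' : list factor) :
  fac_majorant r (l ++ l') = fac_majorant r l * fac_majorant r l'.
Proof.
  induction l as [|s l IH]; simpl; [ring|rewrite IH; ring].
Qed.

Lemma fac_majorant_blocks (r : R) (d : nat) (b : nat -> list factor) (N : nat) :
  0 <= r < 1 ->
  (forall k, List.Forall (fun s => (k < snd s)%nat) (b k) /\ (length (b k) <= d)%nat) ->
  fac_majorant r (blocks b N) <= exp (INR d / (1 - r) ^ 2).
Proof.
  intros Hr Hb.
  (* The induction carries the exact partial sum of [d * r^k / (1 - r)] over [k < N]; the term
     [- r^N] is dropped only afterwards. *)
  assert (H : 1 <= fac_majorant r (blocks b N)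
              <= exp (INR d * (1 - r ^ N) / (1 - r) ^ 2)).
  { induction N as [|N IH]; cbn [blocks].
    - simpl. rewrite Rminus_diag, Rmult_0_r. unfold Rdiv; rewrite Rmult_0_l, exp_0; lra.
    - rewrite fac_majorant_app.
      destruct (Hb N) as [F L].
      pose proof (fac_majorant_block r N d (b N) Hr F L).
      split; [nra|].
      replace (INR d * (1 - r ^ S N) / (1 - r) ^ 2)
        with (INR d * r ^ N / (1 - r) + INR d * (1 - r ^ N) / (1 - r) ^ 2)
        by (simpl; field; lra).
      rewrite exp_plus; apply Rmult_le_compat; lra. }
  eapply Rle_trans; [apply H|].
  apply exp_le_compat.
  assert (0 <= r ^ N) by (apply pow_le; lra).
  pose proof (pos_INR d).
  apply Rmult_le_compat_r; [left; apply Rinv_0_lt_compat; apply pow_lt; lra|nra].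
Qed.

(** A factor with exponent [m > k] affects only indices at least [m], because the shifted sequence
    vanishes below [m]. Since [blocks] puts the newest block in front, this lemma strips it off. *)
Lemma coeffs_app_low (k : nat) (l l' : list factor) (n : nat) :
  List.Forall (fun s => (k < snd s)%nat) l -> (n <= k)%nat ->
  coeffs (l ++ l') n = coeffs l' n.
Proof.
  intros Hl Hn; induction Hl as [|[e m] l Hm Hl IH]; [reflexivity|].
  cbn [snd] in Hm.
  cbn [app coeffs]; unfold fac_coeffs; cbn [fst snd].
  destruct e; [rewrite div_fac_eq by lia|unfold mul_fac]; unfold zshift;
    (destruct (Nat.ltb_spec n m); [rewrite IH; lia|lia]).
Qed.

(** A diagonal choice: when block [k] has only exponents above [k], the blocks from index [n] on
    leave coefficient [n] unchanged. Each limit coefficient is thus read off a finite product. *)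
Definition lim_coeffs (b : nat -> list factor) (n : nat) : Z := coeffs (blocks b n) n.

Lemma coeffs_blocks_stable (b : nat -> list factor) (N n : nat) :
  (forall k, List.Forall (fun s => (k < snd s)%nat) (b k)) -> (n <= N)%nat ->
  coeffs (blocks b N) n = lim_coeffs b n.
Proof.
  intros Hb Hn; induction Hn as [|N Hn IH]; [reflexivity|].
  cbn [blocks]; rewrite (coeffs_app_low N); auto.
Qed.

(** * Complex power series with integer coefficients: convergence and tails *)

Definition is_zps (a : nat -> Z) (q v : C) : Prop :=
  is_pseries (K := C_AbsRing) (V := C_NormedModule) (fun n => RtoC (IZR (a n))) q v.

Definition zterm (a : nat -> Z) (q : C) (n : nat) : C :=
  scal (K := C_AbsRing) (V := C_NormedModule) (pow_n (K := C_AbsRing) q n) (RtoC (IZR (a n))).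

Definition Ctends (u : nat -> C) (l : C) : Prop :=
  filterlim u eventually (locally (T := C_NormedModule) l).

Lemma Ctends_eps (u : nat -> C) (l : C) :
  Ctends u l <->
  forall eps : R, 0 < eps -> exists N, forall n, (N <= n)%nat -> Cmod (u n - l) < eps.
Proof.
  unfold Ctends; split.
  - intros H eps He.
    apply (proj1 (filterlim_locally_ball_norm (K := C_AbsRing) (U := C_NormedModule) u l) H
             (mkposreal eps He)).
  - intros H; apply (proj2 (filterlim_locally_ball_norm (K := C_AbsRing) (U := C_NormedModule) u l)).
    intros eps; apply (H eps (cond_pos eps)).
Qed.

Lemma Cmod_zterm (a : nat -> Z) (q : C) (n : nat) :
  Cmod (zterm a q n) = Rabs (IZR (a n)) * Cmod q ^ n.
Proof.
  unfold zterm; change (Cmod (pow_n (K := C_AbsRing) q n * RtoC (IZR (a n))) = Rabs (IZR (a n)) * Cmod q ^ n).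
  rewrite Cmod_mult, Cmod_R, Rmult_comm; f_equal.
  induction n as [|n IH].
  - exact Cmod_1.
  - change (Cmod (q * pow_n (K := C_AbsRing) q n) = Cmod q ^ S n).
    rewrite Cmod_mult, IH; reflexivity.
Qed.

(** A bound on a circle of radius [s] larger than [Cmod q] becomes geometric decay of ratio
    [Cmod q / s] at [q]. *)
Lemma zterm_bound (a : nat -> Z) (q : C) (s K : R) (n : nat) :
  0 < s -> Rabs (IZR (a n)) * s ^ n <= K ->
  Cmod (zterm a q n) <= K * (Cmod q / s) ^ n.
Proof.
  intros Hs H; rewrite Cmod_zterm.
  unfold Rdiv; rewrite Rpow_mult_distr, pow_inv.
  assert (0 < s ^ n) by (apply pow_lt; lra).
  replace (Rabs (IZR (a n)) * Cmod q ^ n)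
    with (Rabs (IZR (a n)) * s ^ n * (Cmod q ^ n * / s ^ n)) by (field; lra).
  apply Rmult_le_compat_r; [|exact H].
  apply Rmult_le_pos; [apply pow_le, Cmod_ge_0|left; now apply Rinv_0_lt_compat].
Qed.

Lemma ratio_range (q : C) (s : R) : Cmod q < s -> 0 <= Cmod q / s < 1.
Proof.
  intros H; pose proof (Cmod_ge_0 q); split.
  - apply Rmult_le_pos; [lra|left; apply Rinv_0_lt_compat; lra].
  - apply Rmult_lt_reg_r with s; [lra|]. unfold Rdiv; rewrite Rmult_assoc, Rinv_l; lra.
Qed.

Lemma ex_zps (a : nat -> Z) (q : C) (s K : R) :
  Cmod q < s -> (forall n, Rabs (IZR (a n)) * s ^ n <= K) -> exists v, is_zps a q v.
Proof.
  intros Hq H; pose proof (Cmod_ge_0 q).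
  refine (ex_series_le (K := C_AbsRing) (V := C_CompleteNormedModule) (zterm a q)
            (fun n => K * (Cmod q / s) ^ n) _ _).
  - intros n; apply (zterm_bound a q s K n); [lra|apply H].
  - apply (ex_series_scal (V := R_NormedModule) K (fun n => (Cmod q / s) ^ n)), ex_series_geom.
    pose proof (ratio_range q s Hq); rewrite Rabs_pos_eq; lra.
Qed.

Definition zsum (a : nat -> Z) (q : C) (n : nat) : C :=
  sum_n (G := C_AbelianMonoid) (zterm a q) n.

Lemma zsum_S (a : nat -> Z) (q : C) (n : nat) :
  zsum a q (S n) = (zsum a q n + zterm a q (S n))%C.
Proof. apply (sum_Sn (G := C_AbelianMonoid)). Qed.

Lemma is_zps_tends (a : nat -> Z) (q v : C) : is_zps a q v <-> Ctends (zsum a q) v.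
Proof. reflexivity. Qed.

(** The estimate depends on the coefficients only through [s] and [K], so it is uniform over a
    family of series sharing that bound. *)
Lemma zps_tail (a : nat -> Z) (q v : C) (s K : R) (N : nat) :
  Cmod q < s -> (forall n, Rabs (IZR (a n)) * s ^ n <= K) -> is_zps a q v ->
  Cmod (zsum a q N - v) <= K / (1 - Cmod q / s) * (Cmod q / s) ^ N.
Proof.
  intros Hq H Hv.
  pose proof (Cmod_ge_0 q); pose proof (ratio_range q s Hq) as Hr.
  assert (HT : forall n, Cmod (zterm a q n) <= K * (Cmod q / s) ^ n)
    by (intros n; apply zterm_bound; [lra|apply H]).
  set (r := Cmod q / s) in *.
  assert (HK : 0 <= K).
  { eapply Rle_trans; [|apply (H 0%nat)]; simpl; rewrite Rmult_1_r; apply Rabs_pos. }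
  assert (HI : 0 <= K / (1 - r)).
  { apply Rmult_le_pos; [lra|left; apply Rinv_0_lt_compat; lra]. }
  (* Compare two partial sums first; the difference [r^N - r^(N + p)] makes the geometric estimate
     telescope in [p]. *)
  assert (D : forall p, Cmod (zsum a q N - zsum a q (N + p))
                        <= K / (1 - r) * (r ^ N - r ^ (N + p))).
  { induction p as [|p IH].
    - rewrite Nat.add_0_r. unfold Cminus; rewrite Cplus_opp_r, Cmod_0; right; ring.
    - rewrite Nat.add_succ_r, zsum_S.
      replace (zsum a q N - (zsum a q (N + p) + zterm a q (S (N + p))))%C
        with ((zsum a q N - zsum a q (N + p)) + - zterm a q (S (N + p)))%C by ring.
      eapply Rle_trans; [apply Cmod_triangle|]; rewrite Cmod_opp.
      pose proof (HT (S (N + p))) as HS.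
      assert (HP : 0 <= r ^ (N + p)) by (apply pow_le; lra).
      replace (K / (1 - r) * (r ^ N - r ^ S (N + p)))
        with (K / (1 - r) * (r ^ N - r ^ (N + p)) + K * r ^ (N + p)) by (simpl; field; lra).
      apply Rplus_le_compat; [exact IH|]; eapply Rle_trans; [exact HS|].
      apply Rmult_le_compat_l; [exact HK|]; simpl; nra. }
  (* Pass to the limit in [p]: a sufficiently late partial sum is within [eps] of [v]. *)
  apply le_epsilon; intros eps He.
  destruct (proj1 (Ctends_eps _ _) (proj1 (is_zps_tends a q v) Hv) eps He) as [M HM].
  specialize (HM (N + M)%nat ltac:(lia)); specialize (D M).
  replace (zsum a q N - v)%C
    with ((zsum a q N - zsum a q (N + M)) + (zsum a q (N + M) - v))%C by ring.
  eapply Rle_trans; [apply Cmod_triangle|].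
  assert (0 <= r ^ (N + M)) by (apply pow_le; lra).
  fold r.
  nra.
Qed.

Lemma zsum_ext (a b : nat -> Z) (q : C) (N : nat) :
  (forall n, (n <= N)%nat -> a n = b n) -> zsum a q N = zsum b q N.
Proof.
  intros H; apply (sum_n_ext_loc (G := C_AbelianMonoid)).
  intros n Hn; unfold zterm; now rewrite H.
Qed.

(* Tannery's theorem for a sequence of power series that stabilises
   coefficientwise and is bounded on a larger circle. *)
Lemma zps_limit (c : nat -> nat -> Z) (a : nat -> Z) (q : C) (u : nat -> C) (s K : R) :
  Cmod q < s ->
  (forall N n, Rabs (IZR (c N n)) * s ^ n <= K) ->
  (forall N n, (n <= N)%nat -> c N n = a n) ->
  (forall N, is_zps (c N) q (u N)) ->
  exists v, is_zps a q v /\ Ctends u v.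
Proof.
  intros Hq Hc Hs Hu.
  assert (Ha : forall n, Rabs (IZR (a n)) * s ^ n <= K)
    by (intros n; rewrite <- (Hs n n); auto).
  destruct (ex_zps a q s K Hq Ha) as [v Hv].
  exists v; split; [exact Hv|].
  pose proof (ratio_range q s Hq) as Hr.
  set (A := K / (1 - Cmod q / s)).
  assert (HA : 0 <= A).
  { assert (0 <= K).
    { eapply Rle_trans; [|apply (Ha 0%nat)]; simpl; rewrite Rmult_1_r; apply Rabs_pos. }
    apply Rmult_le_pos; [lra|left; apply Rinv_0_lt_compat; lra]. }
  apply Ctends_eps; intros eps He.
  (* Two tails of size at most [A * (Cmod q / s)^N] will be added; the extra 1 keeps the denominator
     positive when [A] is zero. *)
  destruct (pow_lt_1_zero (Cmod q / s) ltac:(rewrite Rabs_pos_eq; lra)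
              (eps / (2 * A + 1)) ltac:(apply Rdiv_lt_0_compat; lra)) as [M HM].
  exists M; intros N HN; specialize (HM N HN).
  assert (HP : 0 <= (Cmod q / s) ^ N) by (apply pow_le; lra).
  rewrite Rabs_pos_eq in HM by exact HP.
  pose proof (zps_tail (c N) q (u N) s K N Hq (Hc N) (Hu N)) as T1.
  pose proof (zps_tail a q v s K N Hq Ha Hv) as T2.
  fold A in T1, T2.
  (* Up to index [N] the coefficients of [c N] and [a] agree, so both tails are measured from the
     same partial sum. *)
  rewrite (zsum_ext (c N) a q N (Hs N)) in T1.
  replace (u N - v)%C with (- (zsum a q N - u N) + (zsum a q N - v))%C by ring.
  eapply Rle_lt_trans; [apply Cmod_triangle|]; rewrite Cmod_opp.
  apply Rlt_le_trans with ((2 * A + 1) * (eps / (2 * A + 1))); [|right; field; lra].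
  assert ((2 * A + 1) * (Cmod q / s) ^ N < (2 * A + 1) * (eps / (2 * A + 1)))
    by (apply Rmult_lt_compat_l; lra).
  nra.
Qed.

(** * Power series of finite and infinite products of factors *)

Lemma is_zps_unique (a : nat -> Z) (q v w : C) : is_zps a q v -> is_zps a q w -> v = w.
Proof.
  apply (filterlim_locally_unique (K := C_AbsRing) (V := C_NormedModule)).
Qed.

Lemma pow_n_Cpow (q : C) (n : nat) : pow_n (K := C_AbsRing) q n = (q ^ n)%C.
Proof.
  induction n as [|n IH]; [reflexivity|].
  rewrite Cpow_S, <- IH; reflexivity.
Qed.

Lemma is_zps_mul_fac (a : nat -> Z) (q v : C) (m : nat) :
  is_zps a q v -> is_zps (mul_fac m a) q ((1 - q ^ m) * v)%C.
Proof.
  intros H; unfold is_zps.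
  pose proof (is_pseries_incr_n _ m q v H) as H1.
  pose proof (is_pseries_minus _ _ q _ _ H H1) as H2.
  replace ((1 - q ^ m) * v)%C with (v - q ^ m * v)%C by ring.
  rewrite <- pow_n_Cpow.
  eapply is_pseries_ext; [|exact H2].
  intros n; cbn beta; unfold mul_fac, zshift, PS_minus, PS_plus, PS_opp.
  rewrite PS_incr_n_simplify, minus_IZR, RtoC_minus.
  destruct (Compare_dec.le_lt_dec m n) as [L|L]; destruct (Nat.ltb_spec n m); try lia; reflexivity.
Qed.

Lemma one_minus_pow_neq_0 (q : C) (m : nat) :
  Cmod q < 1 -> (0 < m)%nat -> (1 - q ^ m)%C <> 0.
Proof.
  intros Hq Hm E.
  assert (E1 : (q ^ m)%C = 1) by (replace (q ^ m)%C with (1 - (1 - q ^ m))%C by ring; rewrite E; ring).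
  pose proof (pow_lt_1 (Cmod q) m (conj (Cmod_ge_0 q) Hq) Hm).
  rewrite <- Cmod_pow, E1, Cmod_1 in *; lra.
Qed.

(** For an inverse factor, the growth bound at a radius between [Cmod q] and 1 first gives
    convergence to some [v]. Multiplying back by [1 - q^m] restores the previous series, so
    uniqueness of its sum identifies [v]. *)
Lemma is_zps_coeffs (l : list factor) (q : C) :
  List.Forall (fun s => (0 < snd s)%nat) l -> Cmod q < 1 ->
  is_zps (coeffs l) q (value q l).
Proof.
  intros Hl Hq; pose proof (Cmod_ge_0 q).
  induction Hl as [|[[|] m] l Hm Hl IH]; cbn [snd] in *.
  - apply is_zps_tends, Ctends_eps; intros eps He; exists 0%nat; intros n _.
    replace (zsum (coeffs []) q n) with (RtoC 1).
    + replace (1 - value q [])%C with (RtoC 0) by (cbn [value]; ring).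
      rewrite Cmod_0; exact He.
    + induction n as [|n IHn].
      * unfold zsum; rewrite sum_O; unfold zterm.
        symmetry; exact (Cmult_1_l 1).
      * rewrite zsum_S, <- IHn; unfold zterm.
        symmetry; etransitivity; [|apply Cplus_0_r]; f_equal.
        exact (Cmult_0_r _).
  - change (is_zps (div_fac m (coeffs l)) q (/ (1 - q ^ m) * value q l)%C).
    set (s := (1 + Cmod q) / 2).
    destruct (ex_zps (div_fac m (coeffs l)) q s (/ (1 - s ^ m) * fac_majorant s l)) as [v Hv].
    + unfold s; lra.
    + apply div_fac_bound; [unfold s; lra|exact Hm|].
      apply coeffs_bound; [unfold s; lra|exact Hl].
    + replace (/ (1 - q ^ m) * value q l)%C with v; [exact Hv|].
      pose proof (one_minus_pow_neq_0 q m Hq Hm) as Hn.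
      apply (is_zps_mul_fac _ _ _ m) in Hv.
      assert (E : ((1 - q ^ m) * v)%C = value q l).
      { apply (is_zps_unique (coeffs l) q); [|exact IH].
        eapply is_pseries_ext; [|exact Hv].
        intros n; cbn beta; do 2 f_equal.
        unfold mul_fac; rewrite (div_fac_eq m (coeffs l) n Hm); lia. }
      rewrite <- E; field; exact Hn.
  - apply is_zps_mul_fac, IH.
Qed.

Lemma blocks_limit (b : nat -> list factor) (d : nat) (q : C) :
  (forall k, List.Forall (fun s => (k < snd s)%nat) (b k) /\ (length (b k) <= d)%nat) ->
  Cmod q < 1 ->
  exists v, is_zps (lim_coeffs b) q v /\ Ctends (fun N => value q (blocks b N)) v.
Proof.
  intros Hb Hq; pose proof (Cmod_ge_0 q).
  (* The radius exceeds [Cmod q], for geometric decay, and is below 1, for bounded majorants. *)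
  set (s := (1 + Cmod q) / 2).
  assert (Hpos : forall N, List.Forall (fun s => (0 < snd s)%nat) (blocks b N)).
  { induction N as [|N IH]; cbn [blocks]; [constructor|].
    apply Forall_app; split; [|exact IH].
    eapply Forall_impl; [|apply Hb]. cbn beta; intros; lia. }
  apply (zps_limit (fun N => coeffs (blocks b N)) _ q _ s (exp (INR d / (1 - s) ^ 2))).
  - unfold s; lra.
  - intros N n; eapply Rle_trans.
    + apply coeffs_bound; [unfold s; lra|apply Hpos].
    + apply fac_majorant_blocks; [unfold s; lra|exact Hb].
  - intros N n Hn; apply coeffs_blocks_stable; [apply Hb|exact Hn].
  - intros N; apply is_zps_coeffs; [apply Hpos|exact Hq].
Qed.

(** * Limits of complex sequences *)

Lemma Ctends_unique (u : nat -> C) (l l' : C) : Ctends u l -> Ctends u l' -> l = l'.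
Proof.
  apply (filterlim_locally_unique (K := C_AbsRing) (V := C_NormedModule)).
Qed.

Lemma Ctends_ext (u v : nat -> C) (l : C) :
  (forall n, u n = v n) -> Ctends u l -> Ctends v l.
Proof. intros H; now apply filterlim_ext. Qed.

Lemma Ctends_const (l : C) : Ctends (fun _ => l) l.
Proof. apply (filterlim_const (U := C_UniformSpace)). Qed.

Lemma Ctends_mult (u v : nat -> C) (l l' : C) :
  Ctends u l -> Ctends v l' -> Ctends (fun n => u n * v n)%C (l * l')%C.
Proof.
  intros Hu Hv.
  (* [C] carries two uniform structures, the product one and that of its absolute value;
     [filterlim_mult] uses the second and [Ctends] the first, so neighbourhoods are translated both
     ways. *)
  assert (L : forall x, filter_le (locally (T := C_UniformSpace) x)
                          (locally (T := AbsRing_UniformSpace C_AbsRing) x))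
    by (intros x P; apply locally_C).
  assert (L' : forall x, filter_le (locally (T := AbsRing_UniformSpace C_AbsRing) x)
                          (locally (T := C_UniformSpace) x))
    by (intros x P; apply locally_C).
  eapply filterlim_filter_le_2; [apply L'|].
  eapply filterlim_comp_2.
  - eapply filterlim_filter_le_2; [apply L|exact Hu].
  - eapply filterlim_filter_le_2; [apply L|exact Hv].
  - apply (filterlim_mult (K := C_AbsRing)).
Qed.

Lemma Ctends_pow (u : nat -> C) (l : C) (p : nat) :
  Ctends u l -> Ctends (fun n => u n ^ p)%C (l ^ p)%C.
Proof.
  intros H; induction p as [|p IH].
  - apply Ctends_const.
  - apply (Ctends_mult u (fun n => u n ^ p)%C); assumption.
Qed.

(** * Infinite q-products and the expansion of [R^5] *)

Lemma qpoch_inf_tends (a q v : C) :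
  Ctends (Cprod (fun k => 1 - a * q ^ k)%C) v -> qpoch_inf a q = v.
Proof.
  intros H; unfold qpoch_inf.
  set (u := Cprod _) in *.
  apply (Ctends_unique u); [|exact H].
  apply (filterlim_locally (U := C_UniformSpace)); intros eps.
  (* [lim] is specified on Cauchy filters only; convergence to [v] makes the filter of partial
     products Cauchy, with [v] as centre of the balls. *)
  refine (complete_cauchy (T := C_CompleteNormedModule) (filtermap u eventually) _ _ eps).
  intros e; exists v.
  apply (proj1 (filterlim_locally (U := C_UniformSpace) u v) H).
Qed.

(** The factor of index [k] in [(q^c; q^5)_inf], or its inverse when [e] is [true], as a one-element
    block. *)
Definition progression (e : bool) (c k : nat) : list factor := [(e, (5 * k + c)%nat)].

Lemma Cprod_progression (q : C) (c N : nat) :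
  Cprod (fun k => 1 - q ^ c * (q ^ 5) ^ k)%C N = value q (blocks (progression false c) N).
Proof.
  induction N as [|N IH]; [reflexivity|].
  cbn [Cprod blocks progression app value]; rewrite IH.
  unfold fac_value; cbn [fst snd].
  rewrite Cpow_add_r, Cpow_mult_r; ring.
Qed.

Lemma value_progression_inv (q : C) (c N : nat) :
  Cmod q < 1 -> (0 < c)%nat ->
  (value q (blocks (progression false c) N) * value q (blocks (progression true c) N))%C = 1.
Proof.
  intros Hq Hc; induction N as [|N IH]; cbn [blocks progression app value]; [ring|].
  unfold fac_value; cbn [fst snd].
  pose proof (one_minus_pow_neq_0 q (5 * N + c) Hq ltac:(lia)) as Hn.
  set (x := (1 - q ^ (5 * N + c))%C) in *.
  set (y := value q (blocks (progression false c) N)) in *.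
  set (z := value q (blocks (progression true c) N)) in *.
  transitivity (x * / x * (y * z))%C; [ring|].
  rewrite IH, Cinv_r by exact Hn; ring.
Qed.

(** The fifth power is built in by repeating each factor five times, so the coefficients of [R^5]
    come from a single product and no series has to be raised to a power. *)
Definition RR5_blocks (k : nat) : list factor :=
  repeat (false, (5 * k + 1)%nat) 5 ++ repeat (false, (5 * k + 4)%nat) 5
  ++ repeat (true, (5 * k + 2)%nat) 5 ++ repeat (true, (5 * k + 3)%nat) 5.

Lemma value_RR5_blocks (q : C) (N : nat) :
  value q (blocks RR5_blocks N) =
  (((value q (blocks (progression false 1) N) * value q (blocks (progression false 4) N))
   * (value q (blocks (progression true 2) N) * value q (blocks (progression true 3) N))) ^ 5)%C.
Proof.
  induction N as [|N IH]; [cbn; ring|].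
  cbn [blocks]; rewrite value_app, IH.
  unfold RR5_blocks; cbn [progression repeat app value].
  ring.
Qed.

Lemma progression_limit (e : bool) (c : nat) (q : C) :
  (0 < c)%nat -> Cmod q < 1 ->
  exists v, Ctends (fun N => value q (blocks (progression e c) N)) v.
Proof.
  intros Hc Hq.
  destruct (blocks_limit (progression e c) 1 q) as [v [_ Hv]]; [|exact Hq|now exists v].
  intros k; split; [|simpl; lia].
  constructor; [cbn [snd]; lia|constructor].
Qed.

Lemma qpoch_inf_progression (c : nat) (q : C) :
  (0 < c)%nat -> Cmod q < 1 ->
  Ctends (fun N => value q (blocks (progression false c) N)) (qpoch_inf (q ^ c) (q ^ 5)).
Proof.
  intros Hc Hq; destruct (progression_limit false c q Hc Hq) as [v Hv].
  rewrite (qpoch_inf_tends (q ^ c) (q ^ 5) v); [exact Hv|].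
  eapply Ctends_ext; [|exact Hv].
  intros N; symmetry; apply Cprod_progression.
Qed.

(** The products of the inverse factors converge too. At every finite stage the two products
    multiply to 1, hence so do their limits, which gives both non-vanishing and the value of the
    second limit. *)
Lemma inv_qpoch_inf_progression (c : nat) (q : C) :
  (0 < c)%nat -> Cmod q < 1 ->
  qpoch_inf (q ^ c) (q ^ 5) <> 0 /\
  Ctends (fun N => value q (blocks (progression true c) N)) (/ qpoch_inf (q ^ c) (q ^ 5))%C.
Proof.
  intros Hc Hq.
  pose proof (qpoch_inf_progression c q Hc Hq) as H.
  destruct (progression_limit true c q Hc Hq) as [w Hw].
  set (v := qpoch_inf (q ^ c) (q ^ 5)) in *.
  assert (E : (v * w)%C = 1).
  { eapply Ctends_unique; [exact (Ctends_mult _ _ _ _ H Hw)|].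
    apply (Ctends_ext (fun _ => RtoC 1)); [|apply Ctends_const].
    intros N; symmetry; now apply value_progression_inv. }
  assert (Hv : v <> 0).
  { intros Z; rewrite Z, Cmult_0_l in E; apply C1_nz; now symmetry. }
  split; [exact Hv|].
  replace (/ v)%C with w; [exact Hw|].
  replace w with (/ v * (v * w))%C by (field; exact Hv).
  rewrite E; ring.
Qed.

(** The partial products of [RR5_blocks] have two descriptions of their limit: the sum of the stable
    series, and the fifth power of the quotient of the four q-products. Uniqueness of limits equates
    them. *)
Lemma RR5_is_zps (q : C) : Cmod q < 1 -> is_zps (lim_coeffs RR5_blocks) q (RR q ^ 5)%C.
Proof.
  intros Hq.
  (* A block has four kinds of factor, five copies of each. *)
  destruct (blocks_limit RR5_blocks 20 q) as [v [Hv Hl]]; [|exact Hq|].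
  { intros k; split; [|simpl; lia].
    unfold RR5_blocks; cbn [repeat app].
    repeat (constructor; [cbn [snd]; lia|]); constructor. }
  replace (RR q ^ 5)%C with v; [exact Hv|].
  eapply Ctends_unique; [exact Hl|].
  apply (Ctends_ext _ _ _ (fun N => eq_sym (value_RR5_blocks q N))).
  destruct (inv_qpoch_inf_progression 2 q ltac:(lia) Hq) as [N2 H2].
  destruct (inv_qpoch_inf_progression 3 q ltac:(lia) Hq) as [N3 H3].
  pose proof (qpoch_inf_progression 1 q ltac:(lia) Hq) as H1.
  pose proof (qpoch_inf_progression 4 q ltac:(lia) Hq) as H4.
  rewrite Cpow_1_r in H1.
  replace (RR q) with (qpoch_inf q (q ^ 5) * qpoch_inf (q ^ 4) (q ^ 5)
    * (/ qpoch_inf (q ^ 2) (q ^ 5) * / qpoch_inf (q ^ 3) (q ^ 5)))%C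
    by (unfold RR; field; split; assumption).
  apply Ctends_pow.
  exact (Ctends_mult _ _ _ _ (Ctends_mult _ _ _ _ H1 H4) (Ctends_mult _ _ _ _ H2 H3)).
Qed.

(** * Uniqueness of the coefficients, by restriction to the real line *)

Lemma is_pseries_Re (B : nat -> R) (x : R) (v : C) :
  is_pseries (K := C_AbsRing) (V := C_NormedModule) (fun n => RtoC (B n)) (RtoC x) v ->
  is_pseries B x (Re v).
Proof.
  intros H'; pose proof (proj1 (Ctends_eps _ _) H') as H.
  apply (filterlim_locally_ball_norm (K := R_AbsRing) (U := R_NormedModule)).
  intros eps; destruct (H eps (cond_pos eps)) as [N HN]; exists N; intros n Hn.
  specialize (HN n Hn).
  eapply Rle_lt_trans; [|exact HN].
  eapply Rle_trans; [|apply Rmax_Cmod].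
  eapply Rle_trans; [|apply Rmax_l].
  right; change (Rabs (sum_n (fun k => pow_n x k * B k) n - Re v) =
    Rabs (Re (sum_n (G := C_AbelianMonoid) (fun k => scal (K := C_AbsRing) (V := C_NormedModule)
      (pow_n (K := C_AbsRing) (RtoC x) k) (RtoC (B k))) n) - Re v)).
  do 2 f_equal.
  assert (T : forall k, scal (K := C_AbsRing) (V := C_NormedModule)
      (pow_n (K := C_AbsRing) (RtoC x) k) (RtoC (B k)) = RtoC (pow_n x k * B k)).
  { intros k; rewrite RtoC_mult, pow_n_Cpow, pow_n_pow, RtoC_pow; reflexivity. }
  clear -T; induction n as [|n IH].
  - rewrite !sum_O, T; reflexivity.
  - rewrite !sum_Sn, T, IH; reflexivity.
Qed.

(** Were the radius below [x], the terms at [x] could not tend to zero, contradicting convergence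
    there. *)
Lemma CV_radius_pos (a : nat -> R) (x : R) : 0 < x -> ex_pseries a x -> Rbar_lt 0 (CV_radius a).
Proof.
  intros Hx [l Hl].
  apply Rbar_lt_le_trans with (Finite x); [exact Hx|].
  apply Rbar_not_lt_le; intros L.
  apply (CV_disk_outside a x).
  - now rewrite Rabs_pos_eq by lra.
  - apply ex_series_lim_0; exists l.
    eapply is_series_ext; [|exact Hl].
    intros n; rewrite pow_n_pow; apply Rmult_comm.
Qed.

(** The coefficients are real, so at real [x] in the unit interval both series sum to the real part
    of [RR x ^ 5]. Real power series of positive radius that agree near 0 have equal
    coefficients. *)
Lemma RR5_expansion_coeffs (B : nat -> R) (n : nat) :
  RR5_expansion B -> B n = IZR (lim_coeffs RR5_blocks n).
Proof.
  intros H.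
  assert (P : forall x, Rabs x < 1 ->
    is_pseries B x (Re (RR x ^ 5)) /\
    is_pseries (fun k => IZR (lim_coeffs RR5_blocks k)) x (Re (RR x ^ 5))).
  { intros x Hx; split; apply is_pseries_Re.
    - apply H; now rewrite Cmod_R.
    - apply RR5_is_zps; now rewrite Cmod_R. }
  assert (Hh : Rabs (1 / 2) < 1) by (rewrite Rabs_pos_eq; lra).
  apply (PSeries_ext_recip B (fun k => IZR (lim_coeffs RR5_blocks k)) n).
  - apply (CV_radius_pos _ (1 / 2)); [lra|eexists; apply (P _ Hh)].
  - apply (CV_radius_pos _ (1 / 2)); [lra|eexists; apply (P _ Hh)].
  - exists (mkposreal 1 Rlt_0_1); intros x Hx.
    change (Rabs (x - 0) < 1) in Hx; rewrite Rminus_0_r in Hx.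
    destruct (P x Hx) as [P1 P2].
    now rewrite (is_pseries_unique _ _ _ P1), (is_pseries_unique _ _ _ P2).
Qed.

Theorem theorem1p7 :
  (exists B : nat -> R, RR5_expansion B) /\
  (forall B : nat -> R, RR5_expansion B -> B 0%nat > 0 /\ B 5%nat < 0).
Proof.
  split.
  - exists (fun n => IZR (lim_coeffs RR5_blocks n)); exact RR5_is_zps.
  - intros B HB; rewrite !(RR5_expansion_coeffs B _ HB).
    (* Both are coefficients of finite products, the empty one for index 0 and one of five blocks,
       100 factors, for index 5; exact integer computation evaluates them. *)
    assert (E0 : lim_coeffs RR5_blocks 0 = 1%Z) by (vm_compute; reflexivity).
    assert (E5 : lim_coeffs RR5_blocks 5 = (-26)%Z) by (vm_compute; reflexivity).
    rewrite E0, E5; lra.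
Qed.
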